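(* If $\aleph_1=\mathfrak{b}$, $\mathfrak{d}=\aleph_2=\mathfrak{c}$ and $2^{\mathfrak{b}}>\mathfrak{c}$, then there is a $2^{\mathfrak{b}}$-sized family $\mathcal{S}$ of Menger subsets of the reals such that (i) for all $M$ from $\mathcal{S}$, $\mathbf{k}(M)$ is incomparable (under $\ge_T$) with $\omega^\omega$ and strictly above $(\omega^\omega,\le_\infty)\times\omega$, and (ii) $\mathbf{k}(M)\neq_T\mathbf{k}(N)$ for all distinct $M$ and $N$ from $\mathcal{S}$.
   Context: A relation is a triple $\mathbf{A}=(A_-,A_+,A)$ of sets $A_-,A_+$ and a binary predicate $xAy$ for $x\in A_-$, $y\in A_+$; $(A',A)$ abbreviates $(A',A',A)$. A (Tukey) morphism from $\mathbf{A}$ to $\mathbf{B}$ is a pair $(\psi_-,\phi_+)$ of functions $\psi_-:B_-\to A_-$, $\phi_+:A_+\to B_+$ such that $\psi_-(b)\,A\,a$ implies $b\,B\,\phi_+(a)$ for all $b\in B_-$, $a\in A_+$. Write $\mathbf{A}\ge_T\mathbf{B}$ if there is such a morphism, $\mathbf{A}=_T\mathbf{B}$ if $\mathbf{A}\ge_T\mathbf{B}$ and $\mathbf{B}\ge_T\mathbf{A}$, and $\neq_T$ for the negation of $=_T$; $\mathbf{A}$ is strictly above $\mathbf{B}$ if $\mathbf{A}\ge_T\mathbf{B}$ and $\mathbf{B}\not\ge_T\mathbf{A}$. For a space $X$: $\mathrm{NC}(X)$ is the set of non-closed subsets of $X$; $\mathcal{K}(X)$ is the set of compact subsets; $S\,(\neg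 c)\,T$ means that $S\cap T$ is not closed in $T$; and $\mathbf{k}(X)=(\mathrm{NC}(X),\mathcal{K}(X),\neg c)$. $\omega$ denotes $(\omega,\le)$; $\omega^\omega$ denotes $(\omega^\omega,\le)$ with the pointwise order; $f\le_\infty g$ means $f(n)\le g(n)$ for infinitely many $n$; $\mathbf{A}\times\mathbf{B}=(A_-\times B_-,A_+\times B_+,A\times B)$, with the predicate coordinatewise. $\mathfrak{b}$ (respectively $\mathfrak{d}$) is the minimum size of an unbounded (respectively cofinal) subset of $\omega^\omega$ under the mod-finite order $\le^*$; $\mathfrak{c}$ is the cardinality of the continuum. A space $X$ is Menger if for every sequence $(\mathcal{U}_n)_n$ of open covers there are finite $\mathcal{V}_n\subseteq\mathcal{U}_n$ such that $\bigcup_n\mathcal{V}_n$ covers $X$. Subsets of the reals carry the subspace topology. *)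

(* Defs.v *)
From HB Require Import structures.
From mathcomp Require Import all_boot all_order all_algebra.
From mathcomp Require Import all_classical all_reals all_analysis.

Set Implicit Arguments.
Unset Strict Implicit.
Unset Printing Implicit Defensive.

Local Open Scope classical_set_scope.
Local Open Scope card_scope.

Record relation := Relation {
  rneg : Type;
  rpos : Type;
  rrel : rneg -> rpos -> Prop }.

Definition diag_relation (T : Type) (r : T -> T -> Prop) : relation :=
  Relation r.

Definition tukey_morphism (A B : relation)
    (psi : rneg B -> rneg A) (phi : rpos A -> rpos B) : Prop :=
  forall (b : rneg B) (a : rpos A), rrel (psi b) a -> rrel b (phi a).

Definition tukey_ge (A B : relation) : Prop :=
  exists psi phi, @tukey_morphism A B psi phi.

Definition tukey_eq (A B : relation) : Prop := tukey_ge A B /\ tukey_ge B A.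

Definition tukey_incomparable (A B : relation) : Prop :=
  ~ tukey_ge A B /\ ~ tukey_ge B A.

Definition strictly_above (A B : relation) : Prop :=
  tukey_ge A B /\ ~ tukey_ge B A.

Definition prod_relation (A B : relation) : relation :=
  @Relation (rneg A * rneg B)%type (rpos A * rpos B)%type
    (fun x y => rrel x.1 y.1 /\ rrel x.2 y.2).

(* [subspace K] induces on [K] its subspace topology and makes the points
   outside [K] isolated, so a subset of [K] is closed in [subspace K] exactly
   when it is closed in [K]. *)
Definition closed_in (X : topologicalType) (S K : set X) : Prop :=
  closed (S : set (subspace K)).

Definition k_relation (X : topologicalType) : relation :=
  @Relation {S : set X | ~ closed S} {K : set X | compact K}
    (fun S K => ~ closed_in (sval S `&` sval K) (sval K)).

Definition omega : relation := diag_relation (fun m n : nat => (m <= n)%N).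

Definition omega_omega : relation :=
  diag_relation (fun f g : nat -> nat => forall n, (f n <= g n)%N).

Definition omega_omega_infty : relation :=
  diag_relation
    (fun f g : nat -> nat => infinite_set [set n | (f n <= g n)%N]).

Definition le_star (f g : nat -> nat) : Prop :=
  finite_set [set n | ~ (f n <= g n)%N].

Definition unbounded (B : set (nat -> nat)) : Prop :=
  ~ exists g, forall f, B f -> le_star f g.

Definition cofinal (D : set (nat -> nat)) : Prop :=
  forall g, exists2 f, D f & le_star g f.

(* A cardinal number is represented by any set having that cardinality:
   [bounding_number B] means |B| = b and [dominating_number D] means |D| = d,
   the sets being determined up to equipotence. *)
Definition bounding_number (B : set (nat -> nat)) : Prop :=
  unbounded B /\ forall B', unbounded B' -> (B #<= B').

Definition dominating_number (D : set (nat -> nat)) : Prop :=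
  cofinal D /\ forall D', cofinal D' -> (D #<= D').

Definition card_lt (T U : Type) (A : set T) (B : set U) : Prop :=
  (A #<= B) /\ ~ (B #<= A).

(* By comparability of cardinals, it is enough that no subset of [B] has a
   cardinality strictly between those of [A] and [B]. *)
Definition successor_card (T U : Type) (A : set T) (B : set U) : Prop :=
  card_lt A B /\ forall C : set U, C `<=` B -> (C #<= A) \/ (B #<= C).

(* [aleph n A] means |A| = aleph_n; a set of smaller cardinality always has a
   copy inside [T], so [B] may be taken in the same type as [A]. *)
Fixpoint aleph (n : nat) (T : Type) (A : set T) : Prop :=
  if n is m.+1 then exists2 B : set T, aleph m B & successor_card B A
  else A #= [set: nat].

Definition power_set (T : Type) (A : set T) : set (set T) :=
  [set C | C `<=` A].

Definition open_cover (X : topologicalType) (U : set (set X)) : Prop :=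
  (forall O, U O -> open O) /\ \bigcup_(O in U) O = [set: X].

Definition menger (X : topologicalType) : Prop :=
  forall U : nat -> set (set X), (forall n, open_cover (U n)) ->
  exists V : nat -> set (set X),
    (forall n, V n `<=` U n /\ finite_set (V n)) /\
    \bigcup_n (\bigcup_(O in V n) O) = [set: X].

(* Main.v *)
Require Import Defs.
From HB Require Import structures.
From mathcomp Require Import finmap all_boot all_order all_algebra.
From mathcomp Require Import all_classical all_reals all_analysis.
From mathcomp Require Import borel_hierarchy lra.

(** Fix an injection [e] of Baire space into the negative reals.  The family
    consists of sets [N_B = Q `|` e(B)] with [B] ranging over the
    [2^b] subsets of [b]; almost all of them have the required position in the
    Tukey order, and few of them can be Tukey equivalent.

    Every [N_B] has at most [b = aleph_1 < d] points, so no family of functions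
    indexed by [N_B] is cofinal ([undominated]).  This gives the Menger property
    and, by [k_set_nge_omega_omega], that [k(N_B)] is not above [omega^omega]:
    given a morphism, the functions whose non-closed set misses a prescribed
    limit point [p] are pointwise bounded, since countably many sets
    accumulating at [p] can be met by one compact set converging to [p]; the
    bounds, one for each point of [N_B], would form a cofinal family.

    On the positive half-line [N_B] is just the set of rationals.  Around each
    natural number it is not locally compact, and sequences of rationals
    approaching irrationals encode a pair [(f, n)] as a sequence converging to
    [n]; this places [(omega^omega, <=_infty) x omega] below [k(N_B)]
    ([k_set_ge_infty_omega]).

    The remaining claims follow from a counting argument.  The compact sets of
    a space [M] of reals carry a countable family of upper Vietoris neighbourhoods
    such that a sequence converging to a compact set has a compact union with
    its limit; [omega^omega] has the analogous property.  Call such relations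
    [countably_based].  If [A] is countably based and [A >=_T k(N)] with [N]
    crowded, then [N] is the union over [a] in [A_+] of closed sets computed from
    countably many bits ([cone_coding]).  Hence only continuum many [N] lie below
    a given [A].  Taking [A = omega^omega] discards at most [c] of the [N_B];
    the others are not below [omega^omega], and a fortiori not below
    [(omega^omega, <=_infty) x omega].  Taking [A = k(N_B)] shows that each
    Tukey class contains at most [c] of them.  Since [2^b > c], a system of
    representatives of the remaining classes still has [2^b] elements
    ([card_transversal]). *)

Set Implicit Arguments.
Unset Strict Implicit.
Unset Printing Implicit Defensive.
Import Order.TTheory GRing.Theory Num.Theory.
Import numFieldNormedType.Exports.

Local Open Scope classical_set_scope.
Local Open Scope card_scope.

(** * Cardinal arithmetic *)

Definition embeds (T U : Type) := exists f : T -> U, injective f.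
Local Notation "T ≼ U" := (embeds T U) (at level 70).

Lemma embeds_trans T U V : T ≼ U -> U ≼ V -> T ≼ V.
Proof. by move=> [f If] [g Ig]; exists (g \o f); apply: inj_comp. Qed.

Lemma embeds_prod T T' U U' : T ≼ T' -> U ≼ U' -> (T * U)%type ≼ (T' * U')%type.
Proof.
move=> [f If] [g Ig]; exists (fun p => (f p.1, g p.2)).
by move=> [x y] [x' y'] /= [] /If -> /Ig ->.
Qed.

Lemma embeds_card_le T U (A : set T) (B : set U) :
  (set_type A ≼ set_type B) <-> (A #<= B).
Proof.
split=> [[f If]|/card_leP[f]].
- by apply/card_leP; apply/injfunPex; exists f => // x y _ _ /If.
- exists f => x y fxy; exact: (@inj _ _ _ f x y (mem_set I) (mem_set I) fxy).
Qed.

(** Comparability of cardinals: a maximal partial injection is total or onto. *)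
Lemma embeds_total T U : T ≼ U \/ U ≼ T.
Proof.
pose P := [set G : set (T * U) |
  forall p q, G p -> G q -> p.1 = q.1 <-> p.2 = q.2].
have [F FP totF|G [PG Gmax]] := @Zorn_bigcup _ P.
  move=> p q [X FX Xp] [Y FY Yq].
  have [XY|YX] := totF _ _ FX FY.
    exact: (FP _ FY _ _ (XY _ Xp) Yq).
  exact: (FP _ FX _ _ Xp (YX _ Yq)).
have [domG|] := pselect (forall x, exists y, G (x, y)).
  left; have [f fG] := choice domG; exists f => x y fxy.
  exact: (iffRL (PG _ _ (fG x) (fG y)) fxy).
move=> /existsNP[x /forallNP nx].
right; have ranG : forall y, exists x, G (x, y).
  apply: contrapT => /existsNP[y /forallNP ny].
  apply: (Gmax (G `|` [set (x, y)])).
    split; first by move=> z; left.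
    by move=> /(_ (x, y) (or_intror erefl)) /nx.
  move=> [p1 p2] [q1 q2] [Gp|[-> ->]] [Gq|[-> ->]] //=.
  - exact: PG Gp Gq.
  - by split=> eq; move: Gp; rewrite eq; [move=> /nx|move=> /ny].
  - by split=> eq; move: Gq; rewrite -eq; [move=> /nx|move=> /ny].
have [g gG] := choice ranG; exists g => x' y gxy.
exact: (iffLR (PG _ _ (gG x') (gG y)) gxy).
Qed.

(** Multiplication by a cardinal [C <= T] with [C * C <= C] changes nothing:
    a maximal disjoint family [E] of copies of [C] in [T] leaves a remainder
    smaller than [C], so [T] is essentially [E * C], and the factor [C] absorbs
    another one. *)
Lemma embeds_absorb C T : (C * C)%type ≼ C -> bool ≼ C -> C ≼ T ->
  (T * C)%type ≼ T.
Proof.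
move=> CC bC [i0 Ii0].
pose I := {f : C -> T | injective f}.
have [E [_ tE maxE]] :=
  ex_maximal_disjoint_subcollection (fun f : I => range (sval f)) setT.
pose r := ~` \bigcup_(f in E) range (sval f).
have [[g Ig]|nCr] := pselect (C ≼ set_type r); last first.
- have rC : set_type r ≼ C by have [] := embeds_total (set_type r) C.
  have [[f0 Ef0]|E0] := pselect (exists f, E f); last first.
    exfalso; apply: nCr; have rT x : x \in r.
      by apply/mem_set => -[f Ef _]; apply: E0; exists f.
    exists (fun c => SigSub (rT (i0 c))) => c c' /(congr1 val) /=; exact: Ii0.
  have TE : T ≼ (set_type E * (bool * C))%type.
    (* A point of the remainder is filed in the copy [f0], under the other
       boolean tag. *)
    have [j Ij] := rC.
    pose Q (t : T) (e : set_type E * (bool * C)) :=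
      (e.2.1 = false /\ sval (val e.1) e.2.2 = t) \/
      (e.2.1 = true /\ exists2 u : set_type r, val u = t & j u = e.2.2).
    have tot t : exists e, Q t e.
      have [[f Ef [c _ fct]]|nt] := pselect ((\bigcup_(f in E) range (sval f)) t).
        by exists (SigSub (mem_set Ef), (false, c)); left.
      have rt : t \in r by exact: mem_set.
      exists (SigSub (mem_set Ef0), (true, j (SigSub rt))); right.
      by split=> //; exists (SigSub rt).
    have [h hQ] := choice tot; exists h => t t' htt'.
    have := hQ t'; rewrite -htt'.
    case: (hQ t) => [[e1 e2]|[e1 [u ut ju]]] [[e1' e2']|[e1' [u' ut' ju']]].
    - by rewrite -e2 -e2'.
    - by move: e1; rewrite e1'.
    - by move: e1; rewrite e1'.
    - by rewrite -ut -ut'; congr (val _); apply: Ij; rewrite ju ju'.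
  have ET : (set_type E * C)%type ≼ T.
    exists (fun p => sval (val p.1) p.2) => -[[f Ef] c] [[f' Ef'] c'] /= ff'.
    have ef : f = f'.
      apply: tE; [exact: set_mem Ef|exact: set_mem Ef'|].
      by exists (sval f c); split; [exists c|rewrite ff'; exists c'].
    move: Ef' ff'; rewrite -ef => Ef' /(svalP f) ->.
    by rewrite (Prop_irrelevance Ef Ef').
  apply: embeds_trans ET; apply: (@embeds_trans _ (set_type E * (bool * C) * C)).
    by apply: embeds_prod => //; exists id.
  apply: (@embeds_trans _ (set_type E * (C * C * C))).
    have [k Ik] := bC; exists (fun p => (p.1.1, (k p.1.2.1, p.1.2.2, p.2))).
    by move=> [[x [y z]] t] [[x' [y' z']] t'] /= [-> /Ik -> -> ->].
  apply: embeds_prod; first by exists id.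
  apply: (embeds_trans _ CC); apply: embeds_prod => //; by exists id.
- exfalso; pose g' := fun c => val (g c).
  have Ig' : injective g' by move=> c c' /val_inj/Ig.
  (* A copy of [C] in the remainder would extend the maximal family. *)
  pose h : I := exist _ g' Ig'.
  have hr c : r (g' c) by exact: (set_valP (g c)).
  have [c0] : exists c : C, True by have [k _] := bC; exists (k true).
  move=> _.
  apply: (maxE (E `|` [set h])).
  - split; first by move=> x; left.
    move=> /(_ h (or_intror erefl)) Eh; apply: (hr c0).
    by exists h => //; exists c0.
  - by [].
  - move=> f f' [Ef|->] [Ef'|->] //; first exact: tE.
      by move=> [_ [[c _ <-] [c' _ cc']]]; case: (hr c'); exists f => //; exists c.
    by move=> [_ [[c _ <-] [c' _ cc']]]; case: (hr c); exists f' => //; exists c'.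
Qed.

(** If the classes of an equivalence on [X], and the union of the bad classes,
    are parametrized by a cardinal [C] that is smaller than [X], then
    representatives of the good classes are as many as the points of [X]:
    a point is determined by its representative and a parameter, so
    [X <= T * C], while [T <= C] would give [X <= C]. *)
Lemma card_transversal X C (r : X -> set X) (bad : set X) (dec : X -> C -> X)
    (dec0 : C -> X) :
  (C * C)%type ≼ C -> bool ≼ C -> ~ (X ≼ C) ->
  (forall x, r x x) -> (forall x y, r x y -> r x = r y) ->
  (forall x y, r x y -> exists c, dec x c = y) ->
  (forall x y, r x y -> bad x -> bad y) ->
  (forall x, bad x -> exists c, dec0 c = x) ->
  exists T : set X, [/\ T #= [set: X], forall x, T x -> ~ bad x &
    forall x y, T x -> T y -> r x y -> x = y].
Proof.
move=> CC bC XnC rxx rE decP badr dec0P.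
(* The representative depends only on the class, seen as a set. *)
have [c cP] : exists c : set X -> X, forall P x, P x -> P (c P).
  have [x0 _] : exists x : X, True.
    apply: contrapT => /forallNP noX; apply: XnC.
    by exists (fun x => match noX x I with end) => x; case: (noX x I).
  suff /choice[c cP] : forall P : set X, exists y, forall x, P x -> P y.
    by exists c.
  move=> P; have [[y Py]|nP] := pselect (P !=set0); first by exists y.
  by exists x0 => x Px; case: nP; exists x.
pose T := [set x | ~ bad x /\ x = c (r x)].
have Tc x : ~ bad x -> T (c (r x)).
  move=> nbx; have rxc : r x (c (r x)) by exact: cP (rxx x).
  split; last by rewrite -(rE _ _ rxc).
  by move=> bc; apply: nbx; apply: badr bc; rewrite -(rE _ _ rxc).
exists T; split; last 2 first.
- by move=> x [].
- by move=> x y [_ xc] [_ yc] /rE e; rewrite xc e -yc.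
have [t0 Tt0] : exists t, T t.
  apply: contrapT => /forallNP noT; apply: XnC.
  have bad_all x : exists k, dec0 k = x.
    by apply: dec0P; apply: contrapT => nbx; exact: (noT _ (Tc _ nbx)).
  have [h hP] := choice bad_all; exists h => x y hxy.
  by rewrite -(hP x) hxy hP.
have XTC : X ≼ (set_type T * (C * C))%type.
  have [k Ik] := bC.
  pose Q x (p : set_type T * (C * C)) :=
    (p.2.2 = k true /\ dec0 p.2.1 = x) \/
    (p.2.2 = k false /\ dec (val p.1) p.2.1 = x).
  have tot x : exists p, Q x p.
    have [/dec0P[a ax]|nbx] := pselect (bad x).
      by exists (SigSub (mem_set Tt0), (a, k true)); left.
    have [|a ax] := decP (c (r x)) x.
      by rewrite -(rE x) //; exact: cP (rxx x).
    by exists (SigSub (mem_set (Tc _ nbx)), (a, k false)); right.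
  have [h hQ] := choice tot; exists h => x y hxy.
  have := hQ y; rewrite -hxy.
  case: (hQ x) => [[e1 e2]|[e1 e2]] [[e1' e2']|[e1' e2']].
  - by rewrite -e2 -e2'.
  - by move: e1; rewrite e1' => /Ik.
  - by move: e1; rewrite e1' => /Ik.
  - by rewrite -e2 -e2'.
rewrite card_eq_le; apply/andP; split; first exact: card_leT.
apply/embeds_card_le.
apply: (@embeds_trans _ X).
  by exists set_val => x y /val_inj.
have Tid : set_type T ≼ set_type T by exists id.
have {}XTC : X ≼ (set_type T * C)%type.
  exact: embeds_trans XTC (embeds_prod Tid CC).
have [TC|CT] := embeds_total (set_type T) C.
  case: XnC; apply: embeds_trans CC; apply: embeds_trans XTC _.
  by apply: embeds_prod => //; exists id.
exact: embeds_trans XTC (embeds_absorb CC bC CT).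
Qed.

Lemma embeds_set_countable (T : countType) : set T ≼ set nat.
Proof.
exists (fun A => pickle @` A) => A B AB; apply/seteqP; split=> x Ax.
- have : (pickle @` B) (pickle x) by rewrite -AB; exists x.
  by move=> [y By /(pcan_inj pickleK) <-].
- have : (pickle @` A) (pickle x) by rewrite AB; exists x.
  by move=> [y By /(pcan_inj pickleK) <-].
Qed.

Lemma embeds_set_nat_prod : (set nat * set nat)%type ≼ set nat.
Proof.
apply: embeds_trans (embeds_set_countable (nat + nat)%type).
exists (fun p => [set x | match x with inl n => p.1 n | inr n => p.2 n end]).
move=> [A B] [A' B'] /= AB; congr pair; apply/predeqP => n.
- by have /predeqP/(_ (inl n)) := AB.
- by have /predeqP/(_ (inr n)) := AB.
Qed.

Lemma embeds_bool_set_nat : bool ≼ set nat.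
Proof.
exists (fun b => [set n | b]) => x y /predeqP/(_ 0) /=.
by case: x; case: y => //= -[] ? ?; exfalso; auto.
Qed.

Lemma embeds_fun_set_nat : (nat -> nat) ≼ set nat.
Proof.
apply: embeds_trans (embeds_set_countable (nat * nat)%type).
exists (fun f => [set p | f p.1 = p.2]) => f g /predeqP fg.
by apply/funext => n; have [/(_ erefl)] := fg (n, f n).
Qed.

(** * Tukey order *)

Lemma tukey_ge_trans A B C : tukey_ge A B -> tukey_ge B C -> tukey_ge A C.
Proof.
move=> [psi [phi h]] [psi' [phi' h']].
by exists (psi \o psi'), (phi' \o phi) => c a /= /h /h'.
Qed.

Lemma tukey_eq_refl A : tukey_eq A A.
Proof. by split; exists id, id. Qed.

Lemma tukey_eq_sym A B : tukey_eq A B -> tukey_eq B A.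
Proof. by case. Qed.

Lemma tukey_eq_trans A B C : tukey_eq A B -> tukey_eq B C -> tukey_eq A C.
Proof. by move=> [? ?] [? ?]; split; apply: tukey_ge_trans; eassumption. Qed.

Lemma omega_omega_ge_infty_omega :
  tukey_ge omega_omega (prod_relation omega_omega_infty omega).
Proof.
exists (fun fn k => maxn (fn.1 k) fn.2), (fun g => (g, g 0%N)).
move=> [f n] g /= fg; split; last by apply: leq_trans (fg 0%N); exact: leq_maxr.
rewrite (_ : [set _ | _] = setT); first exact: infinite_nat.
by apply/seteqP; split=> // k _ /=; apply: leq_trans (fg k); exact: leq_maxl.
Qed.

(** * The relation k of a subspace, computed in the ambient space *)

Definition nonclosed_in (X : topologicalType) (K S : set X) :=
  exists x, [/\ K x, ~ S x & closure (S `&` K) x].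

(** The relation [k] of the subspace [M] with compact sets and non-closed sets
    taken as subsets of the ambient space.  Both its domain and its predicate are
    instances of [nonclosed_in]. *)
Definition k_set (X : topologicalType) (M : set X) : relation :=
  @Relation {S : set X | nonclosed_in M S} {K : set X | compact K /\ K `<=` M}
    (fun S K => nonclosed_in (sval K) (sval S)).

Lemma nonclosed_inW (X : topologicalType) (K L S : set X) :
  K `<=` L -> nonclosed_in K S -> nonclosed_in L S.
Proof.
move=> KL [x [Kx Sx clx]]; exists x; split=> //; first exact: KL.
by apply: closureS clx => y [Sy Ky]; split=> //; exact: KL.
Qed.

Lemma nonclosed_inE (X : topologicalType) (K S : set X) :
  ~ closed_in (S `&` K) K <-> nonclosed_in K S.
Proof.
split=> [nc|[x [Kx Sx clx]] /closed_subspaceP[V cV VK]].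
- apply: contrapT => nnc; apply: nc; apply/closed_subspaceP.
  exists (closure (S `&` K)); first exact: closed_closure.
  apply/seteqP; split=> [x [clx Kx]|x [SKx Kx]]; last first.
    by split=> //; exact: subset_closure.
  split=> //; split=> //; apply: contrapT => Sx.
  by apply: nnc; exists x.
- have : (V `&` K) x.
    split=> //; apply: cV; apply: closureS clx => y SKy.
    suff [] : (V `&` K) y by [].
    by rewrite VK; case: SKy.
  by rewrite VK => -[[]].
Qed.

Lemma closure_set_val (X : topologicalType) (M : set X) (S : set (set_type M)) x :
  closure S x <-> closure (set_val @` S) (set_val x).
Proof.
split=> clx B nB.
- have /clx[y [Sy By]] : nbhs x (set_val @^-1` B).
    exact: (@initial_continuous _ _ set_val x B nB).
  by exists (set_val y); split=> //; exists y.
- case: nB => U [[W oW WU] Ux UB].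
  have : nbhs (set_val x) W.
    by apply: open_nbhs_nbhs; split=> //; move: Ux; rewrite -WU.
  by move=> /clx[_ [[y Sy <-] Wy]]; exists y; split=> //; apply: UB; rewrite -WU.
Qed.

Lemma nonclosed_in_set_val (X : topologicalType) (M : set X)
    (K S : set (set_type M)) :
  nonclosed_in K S <-> nonclosed_in (set_val @` K) (set_val @` S).
Proof.
have SKE : (set_val @` S) `&` (set_val @` K) = set_val @` (S `&` K).
  apply/seteqP; split=> [_ [[y Sy <-] [z Kz zy]]|_ [y [Sy Ky] <-]].
    by exists y => //; split=> //; rewrite -(val_inj zy).
  by split; exists y.
rewrite /nonclosed_in SKE; split=> [[x [Kx Sx /closure_set_val clx]]|].
- exists (set_val x); split=> //.
  by move=> [y Sy /val_inj yx]; apply: Sx; rewrite -yx.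
- move=> [_ [[x Kx <-] Sx /closure_set_val clx]].
  by exists x; split=> // Sx'; apply: Sx.
Qed.

Lemma compact_set_val (X : topologicalType) (M : set X) (K : set (set_type M)) :
  compact K <-> compact (set_val @` K).
Proof.
split=> cK.
  apply: continuous_compact => //; apply: continuous_subspaceT.
  exact: initial_continuous.
move=> F FF FK; have [] := cK (set_val @ F).
  have : F (set_val @^-1` (set_val @` K)) by apply: filterS FK => x Kx; exists x.
  by [].
move=> _ [[x Kx <-] clx]; exists x; split=> // A B FA [U [[W oW WU] Ux UB]].
have [||_ [[a Aa <-] Wa]] := clx (set_val @` A) W.
- have : F (set_val @^-1` (set_val @` A)) by apply: filterS FA => y Ay; exists y.
  by [].
- by apply: open_nbhs_nbhs; split=> //; move: Ux; rewrite -WU.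
by exists a; split=> //; apply: UB; rewrite -WU.
Qed.

Lemma not_closedE (X : topologicalType) (M : set X) (S : set (set_type M)) :
  ~ closed S <-> nonclosed_in M (set_val @` S).
Proof.
have MT : set_val @` [set: set_type M] = M.
  by apply/seteqP; split=> [_ [x _ <-]|x /mem_set Mx];
    [exact: set_valP|exists (SigSub Mx)].
rewrite -[X in nonclosed_in X]MT -nonclosed_in_set_val; split.
- move=> /existsNP[x /not_implyP[clx Sx]].
  by exists x; split=> //; rewrite setIT.
- by move=> [x [_ Sx]]; rewrite setIT => clx cS; apply: Sx; exact: cS.
Qed.

(** Translation along the inclusion of [M], in both directions. *)
Lemma k_setE (X : topologicalType) (M : set X) :
  tukey_eq (k_relation (set_type M)) (k_set M).
Proof.
have valK (S : set X) : S `<=` M ->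
    set_val @` (set_val @^-1` S : set (set_type M)) = S.
  move=> SM; apply/seteqP; split=> [_ [x Sx <-] //|x Sx].
  by exists (SigSub (mem_set (SM _ Sx))).
split.
- have ncS (S : {S : set X | nonclosed_in M S}) :
    ~ closed (set_val @^-1` (sval S `&` M) : set (set_type M)).
    apply/not_closedE; rewrite valK; last by move=> x [].
    case: S => S [x [Mx Sx clx]]; exists x; split=> //=; first by move=> -[].
    by rewrite -setIA setIid.
  have cK (K : {K : set (set_type M) | compact K}) :
      compact (set_val @` sval K) /\ set_val @` sval K `<=` M.
    split; first exact/compact_set_val/(svalP K).
    by move=> _ [x _ <-]; exact: set_valP.
  exists (fun S => exist (fun S : set (set_type M) => ~ closed S) _ (ncS S)),
    (fun K => exist (fun K : set X => compact K /\ K `<=` M) _ (cK K)).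
  move=> S K /nonclosed_inE/nonclosed_in_set_val /=.
  rewrite valK; last by move=> x [].
  move=> [x [Kx Sx clx]]; exists x; split=> //.
    by move=> Sx'; apply: Sx; split=> //; exact: (cK K).2.
  by apply: closureS clx => y [[]].
- have ncS (S : {S : set (set_type M) | ~ closed S}) :
    nonclosed_in M (set_val @` sval S) by exact/not_closedE/(svalP S).
  have cK (K : {K : set X | compact K /\ K `<=` M}) :
      compact (set_val @^-1` sval K : set (set_type M)).
    by case: K => K [cK KM] /=; apply/compact_set_val; rewrite valK.
  exists (fun S => exist (nonclosed_in M) _ (ncS S)),
    (fun K => exist (fun K : set (set_type M) => compact K) _ (cK K)).
  move=> S [K [? KM]] /= SK; apply/nonclosed_inE/nonclosed_in_set_val.
  by rewrite valK.
Qed.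

(** * Approximation and compactness on the real line *)

Section RealLine.
Local Open Scope ring_scope.
Context (R : realType).
Implicit Types (M K S A : set R) (x p : R).

Lemma closure_approx A x : closure A x ->
  exists y : nat -> R, forall n, A (y n) /\ `|x - y n| < n.+1%:R^-1.
Proof.
move=> clx; suff /choice[y yP] : forall n : nat, exists y,
  A y /\ `|x - y| < n.+1%:R^-1 by exists y.
move=> n; have /clx[y [Ay xy]] : nbhs x (ball x (n.+1%:R^-1 : R)).
  by apply: nbhsx_ballx; rewrite invr_gt0 ltr0n.
by exists y.
Qed.

Lemma invS_lt (e : R) : 0 < e -> exists n : nat, n.+1%:R^-1 < e.
Proof.
move=> e0; have /cvgr0_norm_lt/(_ _ e0)[n _ /(_ n (leqnn n))] := @cvg_harmonic R.
rewrite /harmonic /= ger0_norm; last by rewrite invr_ge0.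
by exists n.
Qed.

Lemma approx_closure A x (y : nat -> R) :
  (forall n, A (y n)) -> (forall n, `|x - y n| < n.+1%:R^-1) -> closure A x.
Proof.
move=> Ay xy B /nbhs_ballP[e /= e0 eB]; have [n ne] := invS_lt e0.
exists (y n); split=> //; apply: eB; rewrite /ball /=.
exact: lt_trans ne.
Qed.

(** A set is compact as soon as it has a compact core such that what remains
    outside each open neighbourhood of the core is contained in a compact part:
    a finite subcover of the core is completed by one of the rest. *)
Lemma compact_core (T : ptopologicalType) (a L : set T) :
  compact a -> (forall V, open V -> a `<=` V ->
    exists C, [/\ compact C, C `<=` L & L `\` V `<=` C]) ->
  a `<=` L -> compact L.
Proof.
rewrite compact_cover => ca Lcore aL I D f Dop Lcov.
have [D1 D1D aD1] := ca I D f Dop (subset_trans aL Lcov).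
have [|//|C [cC CL LC]] := Lcore (cover [set` D1] f).
  by apply: bigcup_open => i /D1D/set_mem; exact: Dop.
have [D2 D2D aD2] := cC I D f Dop (subset_trans CL Lcov).
exists (D1 `|` D2)%fset.
  by move=> i; rewrite in_fsetU => /orP[/D1D|/D2D].
move=> x Lx; have [[i D1i fx]|nx] := pselect (cover [set` D1] f x).
  by exists i => //=; rewrite in_fsetU; apply/orP; left.
have [|i D2i fx] := aD2 x; first exact: LC.
by exists i => //=; rewrite in_fsetU; apply/orP; right.
Qed.

Lemma compact_cvg (I : Type) (y : I -> R) x :
  (forall e, 0 < e -> finite_set [set i | ~ `|x - y i| < e]) ->
  compact (x |` range y).
Proof.
move=> yx; apply: (@compact_core _ [set x]); first exact: compact_set1.
- move=> V oV xV.
  have /nbhs_ballP[e /= e0 eV] : nbhs x V.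
    by apply: open_nbhs_nbhs; split=> //; exact: xV.
  exists (y @` [set i | ~ `|x - y i| < e]); split.
  + by apply: finite_compact; apply: finite_image; exact: yx.
  + by move=> _ [i _ <-]; right; exists i.
  + move=> z [[->|[i _ <-]] nV]; first by case: nV; exact: xV.
    by exists i => //= xy; apply: nV; exact: eV.
- by move=> z ->; left.
Qed.

Lemma finite_far x (y : nat -> R) (e : R) : 0 < e ->
  (forall n, `|x - y n| < n.+1%:R^-1) ->
  finite_set [set i | ~ `|x - y i| < e].
Proof.
move=> e0 xy; have [n ne] := invS_lt e0.
apply: (@sub_finite_set _ _ `I_n); last exact: finite_II.
move=> i /= nxy; rewrite ltnNge; apply/negP => ni; apply: nxy.
apply: lt_trans (xy i) (le_lt_trans _ ne).
by rewrite lef_pV2 ?posrE ?ltr0n// ler_nat.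
Qed.

Lemma compact_seq x (y : nat -> R) :
  (forall n, `|x - y n| < n.+1%:R^-1) -> compact (x |` range y).
Proof. by move=> xy; apply: compact_cvg => e e0; exact: finite_far. Qed.

(** The countable base of balls of rational centre and radius 1/(n+1), indexed by
    natural numbers; an index that encodes no such ball gives the empty set. *)
Definition rball (m : nat) : set R :=
  if unpickle m is Some (q, n) then
    [set x | `|ratr (q : rat) - x| < (n : nat).+1%:R^-1] else set0.

Lemma rball_nbhs x (U : set R) : nbhs x U ->
  exists m, rball m x /\ rball m `<=` U.
Proof.
move=> /nbhs_ballP[e /= e0 eU]; have [n ne] : exists n : nat, n.+1%:R^-1 < e / 2.
  by apply: invS_lt; rewrite divr_gt0.
have n0 : 0 < n.+1%:R^-1 :> R by rewrite invr_gt0 ltr0n.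
have /rat_in_itvoo[q /itvP qx] : x < x + n.+1%:R^-1 by rewrite ltrDl.
exists (pickle (q, n)); rewrite /rball pickleK; split=> [|y] /=.
  by rewrite ger0_norm ?subr_ge0 ?ltW ?qx// ltrBlDl qx.
move=> qy; apply: eU; rewrite /ball /=.
have -> : x - y = (x - ratr q) + (ratr q - y) by rewrite addrA subrK.
apply: le_lt_trans (ler_normD _ _) _; rewrite [e]splitr ltrD//; last first.
  exact: lt_trans ne.
apply: lt_trans ne; rewrite distrC ger0_norm ?subr_ge0 ?ltW ?qx// ltrBlDl qx//.
Qed.

Lemma open_rball m : open (rball m).
Proof.
rewrite /rball; case: unpickle => [[q n]|]; last exact: open0.
have -> : [set x | `|ratr q - x| < n.+1%:R^-1] = ball (ratr q : R) (n.+1%:R^-1 : R).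
  by apply/seteqP; split.
by apply: ball_open; rewrite invr_gt0 ltr0n.
Qed.

(** * Consequences of having fewer points than the dominating number *)

Definition undominated M :=
  forall g : R -> nat -> nat, ~ cofinal (g @` M).

(** Let [x f] be a limit point missing from the set assigned to [f].  If the
    functions with [x f = p] took unbounded values at some [m], say on [F k]
    with [F k m > k], then points of all the sets assigned to the [F k],
    chosen closer and closer to [p], would form with [p] one compact set that
    serves every [F k], and its image would bound every [F k m]. *)
Lemma k_set_nge_omega_omega M : undominated M ->
  ~ tukey_ge (k_set M) omega_omega.
Proof.
move=> uM [psi [phi mor]].
have [x xP] := choice (fun f => svalP (psi f)).
suff bnd p m : exists N, forall f, x f = p -> (f m <= N)%N.
  have /choice[g gP] : forall p, exists g : nat -> nat,
      forall m f, x f = p -> (f m <= g m)%N.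
    by move=> p; have [g gP] := choice (bnd p); exists g.
  apply: (uM g) => f; exists (g (x f)); first by exists (x f) => //; case: (xP f).
  rewrite /le_star (_ : [set _ | _] = set0) //.
  by apply/seteqP; split=> n //= /(_ (gP _ _ _ erefl)).
apply: contrapT => /forallNP nbnd.
have /choice[F FP] : forall k, exists f, x f = p /\ (k < f m)%N.
  move=> k; have /existsNP[f /not_implyP[fp /negP]] := nbnd k.
  by rewrite -ltnNge; exists f.
have /choice[y yP] : forall k, exists y : nat -> R, forall n,
    (sval (psi (F k)) `&` M) (y n) /\ `|p - y n| < n.+1%:R^-1.
  move=> k; apply: closure_approx; rewrite -(FP k).1.
  by case: (xP (F k)).
(* The radius at [(k, j)] tends to 0 in both indices, so the whole double
   sequence converges to [p], and so does each of its rows. *)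
pose z (q : nat * nat) := y q.1 (q.1 + q.2)%N.
have Mp : M p by rewrite -(FP 0).1; case: (xP (F 0)).
have cK : compact (p |` range z) /\ p |` range z `<=` M.
  split; last by move=> _ [->//|[q _ <-]]; case: (yP q.1 (q.1 + q.2)%N) => -[].
  apply: compact_cvg => e e0; have [n ne] := invS_lt e0.
  apply: (@sub_finite_set _ _ (`I_n `*` `I_n)); last exact: finite_setX.
  move=> q /= nq; suff : (q.1 + q.2 < n)%N.
    by move=> qn; split=> /=; apply: leq_ltn_trans qn; rewrite ?leq_addr ?leq_addl.
  rewrite ltnNge; apply/negP => nle; apply: nq.
  apply: lt_trans (yP q.1 (q.1 + q.2)%N).2 (le_lt_trans _ ne).
  by rewrite lef_pV2 ?posrE ?ltr0n// ler_nat.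
pose K : rpos (k_set M) := exist (fun K => compact K /\ K `<=` M) _ cK.
have FK k : forall n, (F k n <= phi K n)%N.
  apply: mor; exists p; split=> /=; first by left.
    by rewrite -(FP k).1; case: (xP (F k)).
  apply: (@approx_closure _ _ (fun j => z (k, j))) => j.
    by split; [exact: (yP k (k + j)%N).1.1|right; exists (k, j)].
  apply: lt_le_trans (yP k (k + j)%N).2 _.
  by rewrite lef_pV2 ?posrE ?ltr0n// ler_nat ltnS leq_addl.
have := FK (phi K m) m; rewrite leqNgt => /negP; apply.
exact: (FP (phi K m)).2.
Qed.

(** Let [c n m] be a member of the [n]-th cover containing the [m]-th basic ball,
    if there is one, and [f x n] the index of a suitable ball around [x].
    As the functions [f x] do not dominate, some [g] exceeds each [f x]
    somewhere, and the first [g n] members of the [n]-th list suffice. *)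
Lemma menger_undominated M : undominated M -> menger (set_type M).
Proof.
move=> uM U Ucov.
have /choice[c cP] n : exists c : nat -> set (set_type M), forall m O,
    U n O -> set_val @^-1` (rball m) `<=` O ->
    U n (c m) /\ set_val @^-1` (rball m) `<=` c m.
  suff /choice[C CP] : forall m, exists C, forall O,
    U n O -> set_val @^-1` (rball m) `<=` O ->
    U n C /\ set_val @^-1` (rball m) `<=` C by exists C.
  move=> m.
  have [[C [UC mC]]|nC] := pselect
    (exists C, U n C /\ set_val @^-1` (rball m) `<=` C); first by exists C.
  by exists set0 => O UO mO; case: nC; exists O.
have fP x n : exists m, M x -> rball m x /\
    exists2 O, U n O & set_val @^-1` (rball m) `<=` O.
  have [Mx|] := pselect (M x); last by exists 0%N.
  pose x' : set_type M := SigSub (mem_set Mx).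
  have [oU] := Ucov n; move=> /seteqP[_ /(_ x' I) [W' UW' Wx']].
  have [W oW WO] := oU _ UW'.
  have [|m [mx mW]] := @rball_nbhs x W.
    by apply: open_nbhs_nbhs; split=> //; move: Wx'; rewrite -WO.
  exists m => _; split=> //; exists W' => // z /= /mW.
  by rewrite -WO.
have /choice[f {}fP] : forall x, exists f : nat -> nat, forall n,
    M x -> rball (f n) x /\ exists2 O, U n O & set_val @^-1` (rball (f n)) `<=` O.
  by move=> x; have [f fP'] := choice (fP x); exists f.
have /existsNP[g /forall2NP ng] := uM f.
exists (fun n => U n `&` (c n @` `I_(g n))); split.
  move=> n; split; first by move=> O [].
  by apply: finite_setIr; apply: finite_image; exact: finite_II.
apply/seteqP; split=> // x _.
have [n fg] : exists n, (f (set_val x) n < g n)%N.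
  have [[]|] := ng (f (set_val x)); first by exists (set_val x) => //; exact: set_valP.
  move=> nstar; apply: contrapT => /forallNP nfg; apply: nstar.
  rewrite /le_star (_ : [set _ | _] = set0) //.
  by apply/seteqP; split=> n //= /negP; rewrite -ltnNge => /nfg.
have [mx [W UW mW]] := fP _ n (set_valP x).
have [Uc mc] := cP n _ W UW mW.
exists n => //; exists (c n (f (set_val x) n)); last exact: mc.
by split=> //; exists (f (set_val x) n).
Qed.

End RealLine.

(** * Lower Tukey cones contain at most continuum many sets of reals *)

Section Coding.
Local Open Scope ring_scope.
Context (R : realType).
Implicit Types (M N K S : set R) (x p : R).

(** The sets [U i] play the part of a base of neighbourhoods on [A_+]: the
    hypothesis on [s] says that [s] converges to [a], and the conclusion that a
    convergent sequence is bounded, in the sense that a single [L] does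
    everything that the terms do. *)
Definition countably_based (A : relation) :=
  (forall b : rneg A, exists a, rrel b a) /\
  exists U : nat -> set (rpos A), forall (a : rpos A) (s : nat -> rpos A),
    (forall n i, (i < n)%N -> U i a -> U i (s n)) ->
    exists L, forall n b, rrel b (s n) -> rrel b L.

(** In the product topology, a convergent sequence takes finitely many values at
    each coordinate. *)
Lemma omega_omega_countably_based : countably_based omega_omega.
Proof.
split; first by move=> f; exists f => n; exact: leqnn.
exists (fun i => [set f : nat -> nat |
  if unpickle i is Some (m, v) then f (m : nat) = v else True]) => a s sa.
have sam m n : (pickle (m, a m) < n)%N -> s n m = a m.
  by move=> /sa /=; rewrite pickleK; apply.
exists (fun m => maxn (a m) (\max_(n < (pickle (m, a m)).+1) s n m)).
move=> n b bs m; apply: leq_trans (bs m) _.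
have [mn|nm] := ltnP (pickle (m, a m)) n; first by rewrite sam ?leq_maxl.
rewrite -ltnS in nm; apply: leq_trans (leq_maxr _ _).
exact: (@leq_bigmax _ (fun i : 'I_ _ => s i m) (Ordinal nm)).
Qed.

(** The neighbourhoods are those of the upper Vietoris topology, given by finite
    unions of rational balls: if [s n] converges to [a], then all but finitely
    many [s n] are inside a given neighbourhood of [a], so the union of [a]
    and the [s n] is compact. *)
Lemma k_set_countably_based M : countably_based (k_set M).
Proof.
split.
  move=> S; have [x [Mx Sx /closure_approx[y yP]]] := svalP S.
  have cK : compact (x |` range y) /\ x |` range y `<=` M.
    split; last by move=> _ [->//|[n _ <-]]; case: (yP n) => -[].
    by apply: compact_seq => n; case: (yP n).
  exists (exist (fun K => compact K /\ K `<=` M) _ cK), x; split=> //=.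
    by left.
  apply: (@approx_closure _ _ _ y) => n; last by case: (yP n).
  by split; [case: (yP n) => -[]|right; exists n].
pose U i := [set K : rpos (k_set M) | if unpickle i is Some s then
  sval K `<=` \bigcup_(m in [set` (s : seq nat)]) @rball R m else True].
have UE (s : seq nat) :
    U (pickle s) = [set K | sval K `<=` \bigcup_(m in [set` s]) @rball R m].
  by rewrite /U pickleK.
exists U => a s sa.
pose L := sval a `|` \bigcup_n sval (s n).
have cL : compact L /\ L `<=` M.
  split; last first.
    by move=> x [/(svalP a).2//|[n _ /(svalP (s n)).2]].
  apply: (@compact_core _ (sval a)); first exact: (svalP a).1; last first.
    by move=> x; left.
  move=> V oV aV; have : cover_compact (sval a).
    by rewrite -compact_cover; exact: (svalP a).1.
  move=> /(_ nat [set m | @rball R m `<=` V] (@rball R))[m _|x ax|D DV aD].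
  - exact: open_rball.
  - have [m [mx mV]] : exists m, rball m x /\ @rball R m `<=` V.
      by apply: rball_nbhs; apply: open_nbhs_nbhs; split=> //; exact: aV.
    by exists m.
  exists (\bigcup_(n in `I_(pickle (enum_fset D : seq nat)).+1) sval (s n)); split.
  - rewrite bigcup_mkord; apply: bigsetU_compact => i _; exact: (svalP (s i)).1.
  - by move=> x [n _ snx]; right; exists n.
  - move=> x [[ax|[n _ snx]] nV]; first by case: nV; exact: aV.
    exists n => //=; rewrite ltnS leqNgt; apply/negP => nD.
    have := sa _ _ nD; rewrite UE => /(_ aD) /(_ x snx) [m Dm mx].
    apply: nV; have /set_mem : m \in [set m | @rball R m `<=` V] by exact: DV.
    exact.
exists (exist (fun K => compact K /\ K `<=` M) _ cL) => n S.
by apply: nonclosed_inW => x snx /=; right; exists n.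
Qed.

Definition crowded (X : topologicalType) (N : set X) :=
  forall z, N z -> closure (N `\ z) z.

(** For [x] in [N] let [S x] be the complement of [x]: a compact set meets [S x]
    in a non-closed set only if it contains [x].  A morphism [(psi, phi)] thus
    sends every [a] that is above [psi (S x)] to a compact subset of [N]
    containing [x].  Record in [W] which basic neighbourhoods of [A_+] and which
    balls are related through some [x].  Then [N] consists of the [z] such that,
    for some [a], every neighbourhood of [a] is related to every ball around [z]:
    such a [z] is the limit of points [x n] with [S (x n)] related to some
    [t n] converging to [a]; a bound [L] of the [t n] puts all [x n], and so
    [z], into the compact set [phi L]. *)
Lemma cone_coding (A : relation) : countably_based A ->
  exists dec : set nat -> set R, forall N, crowded N ->
    tukey_ge A (k_set N) -> exists W, dec W = N.
Proof.
move=> [Atot [U UP]].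
exists (fun W => [set z | exists a : rpos A, forall (F : seq nat) m,
  (forall i, i \in F -> U i a) -> rball m z -> W (pickle (F, m))]).
move=> N crN [psi [phi mor]].
exists [set w | exists (F : seq nat) (m : nat), w = pickle (F, m) /\
  exists (a : rpos A) x (S : rneg (k_set N)),
  [/\ forall i, i \in F -> U i a, rball m x, N x, sval S = ~` [set x]
    & rrel (psi S) a]].
apply/seteqP; split=> [z [a aP]|z Nz]; last first.
  have ncz : nonclosed_in N (~` [set z]).
    exists z; split=> //; first by apply.
    by apply: closureS (crN _ Nz) => y [Ny yz].
  pose S : rneg (k_set N) := exist (nonclosed_in N) _ ncz.
  have [a Sa] := Atot (psi S); exists a => F m Fa mz.
  by exists F, m; split=> //; exists a, z, S.
have /choice[t tP] : forall n : nat, exists t : rpos A * R * rneg (k_set N),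
    [/\ forall i, (i < n)%N -> U i a -> U i t.1.1,
        `|z - t.1.2| < n.+1%:R^-1, N t.1.2, sval t.2 = ~` [set t.1.2]
      & rrel (psi t.2) t.1.1].
  move=> n; have [|m [mz mn]] := @rball_nbhs _ z (ball z (n.+1%:R^-1 : R)).
    by apply: nbhsx_ballx; rewrite invr_gt0 ltr0n.
  have [|//|F [m' [/(pcan_inj pickleK)[<- <-]]]] :=
      aP [seq i <- iota 0 n | `[< U i a >] ] m.
    by move=> i; rewrite mem_filter => /andP[/asboolP].
  move=> [a' [x [S [Fa' mx Nx SE Sa']]]].
  exists (a', x, S); split=> //=; last exact: mn.
  move=> i i_n Uia; apply: Fa'; rewrite mem_filter mem_iota i_n andbT.
  apply/andP; split=> //.
  exact/asboolP.
have [n i i_n|L LP] := UP a (fun n => (t n).1.1).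
  by case: (tP n) => + _ _ _ _; exact.
have KL n : sval (phi L) (t n).1.2.
  have [_ _ _ SE /LP/mor[y [Ky]]] := tP n.
  by rewrite SE => /contrapT <-.
have cz : closure (sval (phi L)) z.
  by apply: (@approx_closure _ _ _ (fun n => (t n).1.2)) => // n; case: (tP n).
apply: (svalP (phi L)).2; move: cz.
by rewrite -(closure_id _).1//; exact: compact_closed (svalP (phi L)).1.
Qed.

End Coding.

(** * A fan of divergent sequences around each natural number *)

Section Fan.
Local Open Scope ring_scope.
Context (R : realType).
Implicit Types (M K : set R) (x p : R).

Lemma finite_closed (T : topologicalType) (A : set T) :
  hausdorff_space T -> finite_set A -> closed A.
Proof. by move=> hT fA; apply: compact_closed => //; exact: finite_compact. Qed.

(** Choose [p (n, k)] outside [M] in the interval from [n] to [n + 1/(k+1)], and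
    points [d (n, k, j)] of [M] in that interval converging to [p (n, k)] in [j].
    The pair [(f, n)] is sent to the range of [k |-> d (n, k, f k)], a sequence
    converging to [n].  A compact subset of [M] contains [d (n, k, j)] only for
    [j] up to a bound depending on [n] and [k], as [p (n, k)] is not in it. *)
Lemma k_set_ge_infty_omega M : (forall q : rat, M (ratr q)) ->
  (forall x y, 0 <= x -> x < y -> exists p, [/\ x < p, p < y & ~ M p]) ->
  tukey_ge (k_set M) (prod_relation omega_omega_infty omega).
Proof.
move=> QM codense.
have Mn (n : nat) : M n%:R by have := QM n%:R; rewrite ratr_nat.
have iS0 (n : nat) : 0 < n.+1%:R^-1 :> R by rewrite invr_gt0 ltr0n.
have /choice[p pP] : forall nk : nat * nat, exists p,
    [/\ nk.1%:R < p, p < nk.1%:R + nk.2.+1%:R^-1 & ~ M p].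
  by move=> [n k]; apply: codense => /=; [rewrite ler0n|rewrite ltrDl].
have /choice[d dP] : forall t : nat * nat * nat, exists d,
    [/\ M d, t.1.1%:R < d, d < t.1.1%:R + t.1.2.+1%:R^-1 &
      `|p t.1 - d| < t.2.+1%:R^-1].
  move=> [[n k] j] /=; have [np pk _] := pP (n, k).
  have : Num.max n%:R (p (n, k) - j.+1%:R^-1) < p (n, k).
    by rewrite gt_max np ltrBlDr ltrDl iS0.
  move=> /rat_in_itvoo[q]; rewrite in_itv /= gt_max => /andP[/andP[nq jq] qp].
  exists (ratr q); split=> //; first exact: lt_trans pk.
  by rewrite ger0_norm ?subr_ge0 ?ltW// ltrBlDr -ltrBlDl.
have dn f (n k : nat) : `|n%:R - d (n, k, f k)| < k.+1%:R^-1.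
  have [_ nd dk _] := dP (n, k, f k : nat).
  by rewrite distrC ger0_norm ?subr_ge0 ?ltW// ltrBlDl.
pose S (f : nat -> nat) n := range (fun k => d (n, k, f k)).
have nS f n : ~ S f n n%:R.
  by move=> [k _ dE]; have [_] := dP (n, k, f k); rewrite dE ltxx.
have ncS (fn : (nat -> nat) * nat) : nonclosed_in M (S fn.1 fn.2).
  exists fn.2%:R; split; [exact: Mn|exact: nS|].
  apply: (@approx_closure _ _ _ (fun k => d (fn.2, k, fn.1 k))) => [k|k].
    by split; [exists k|case: (dP (fn.2, k, fn.1 k))].
  exact: dn.
have /choice[b bP] : forall K : rpos (k_set M), exists gN : (nat -> nat) * nat,
    forall n, sval K n%:R -> (n <= gN.2)%N /\
      forall k j, sval K (d (n, k, j)) -> (j <= gN.1 k)%N.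
  move=> [K [cK KM]] /=.
  have [N Nub] : exists N : nat, forall n : nat, K n%:R -> (n <= N)%N.
    have /compact_bounded [m [_ mP]] := cK.
    have {mP} mK := mP (m + 1) (ltr_pwDr ltr01 (lexx _)).
    exists (Num.truncn (m + 1)) => n Kn; rewrite -ltnS -(ltr_nat R).
    apply: le_lt_trans (truncnS_gt _); apply: le_trans (mK _ Kn).
    by rewrite ger0_norm.
  have /choice[b bP] : forall nk, exists b, forall j, K (d (nk, j)) -> (j <= b)%N.
    move=> nk; have [_ _ nMp] := pP nk.
    have /nbhs_ballP[e /= e0 eK] : nbhs (p nk) (~` K).
      apply: open_nbhs_nbhs; split; last by move=> /KM.
      by rewrite openC; exact: compact_closed.
    have [b be] := invS_lt e0; exists b => j Kd.
    rewrite leqNgt; apply/negP => bj; apply: eK Kd; rewrite /ball /=.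
    have [_ _ _ pd] := dP (nk, j); apply: lt_trans pd (le_lt_trans _ be).
    by rewrite lef_pV2 ?posrE ?ltr0n// ler_nat ltnS ltnW.
  (* Only the finitely many [n <= N] can be in [K], so the bounds for them can
     be merged into one function of [k]. *)
  exists (fun k => \max_(n < N.+1) b (n : nat, k), N) => n Kn; split.
    exact: Nub.
  move=> k j /bP jb; apply: leq_trans jb _ => /=.
  have nN : (n < N.+1)%N by rewrite ltnS Nub.
  exact: (@leq_bigmax _ (fun i : 'I_N.+1 => b (i : nat, k)) (Ordinal nN)).
exists (fun fn => exist (nonclosed_in M) _ (ncS fn)), b.
move=> [f n] K /= [x [Kx Sx clx]].
have cS : closed (n%:R |` S f n).
  by apply: compact_closed => //; apply: compact_seq => k; exact: dn.
have xn : x = n%:R.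
  have : (n%:R |` S f n) x.
    by apply: cS; apply: closureS clx => y [Sy _]; right.
  by case.
(* If [f] exceeded the bound almost everywhere, [S f n] would meet [K] in a
   finite set, which cannot accumulate at [n]. *)
subst x; have [nN bK] := bP K n Kx; split=> // fin.
have : (S f n `&` sval K) n%:R.
  rewrite [X in X _](closure_id _).1//; apply: finite_closed => //.
  apply: (@sub_finite_set _ _
    ((fun k => d (n, k, f k)) @` [set k | (f k <= (b K).1 k)%N])).
    by move=> _ [[k _ <-] Kd]; exists k => //=; exact: bK.
  exact: finite_image.
by case.
Qed.

End Fan.

(** * Injections into the continuum *)

Section Reals.
Local Open Scope ring_scope.
Context (R : realType).

Let ternary_sum (A : set nat) (n : nat) : R :=
  \sum_(i < n) (`[< A i >])%:R / 3 ^+ i.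

(* [3/2 * 3^-n] is the sum of all the digits from [n] on when they equal 1, so
   partial sums increase and partial sums plus that tail decrease. *)
Let ternary_sum_mono A m n : (m <= n)%N ->
  ternary_sum A m <= ternary_sum A n /\
  ternary_sum A n + 3 / 2 / 3 ^+ n <= ternary_sum A m + 3 / 2 / 3 ^+ m.
Proof.
move=> /subnK <-; elim: (n - m)%N => [|k [IH1 IH2]]; first by rewrite add0n.
rewrite /ternary_sum addSn big_ord_recr /=.
rewrite -/(ternary_sum A (k + m)) -/(ternary_sum A m).
have t0 : 0 < 3 ^+ (k + m) :> R by rewrite exprn_gt0.
have t1 : 0 < (3 ^+ (k + m))^-1 :> R by rewrite invr_gt0.
rewrite exprS invfM.
move: t1 IH1 IH2; move: (3 ^+ (k + m))^-1 (3 ^+ m)^-1 => t u t1 IH1 IH2.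
by case: `[< _ >] => /=; split; lra.
Qed.

(** Ternary expansions with digits 0 and 1: at the first place [m] where two
    expansions differ, the digit 1 contributes [3^-m], more than the [3^-m / 2]
    that later digits can make up for. *)
Lemma embeds_set_nat_real : set nat ≼ R.
Proof.
pose x A := sup (range (ternary_sum A)).
have ub A n : ubound (range (ternary_sum A)) (ternary_sum A n + 3 / 2 / 3 ^+ n).
  move=> _ [m _ <-]; have p k : 0 < 3 / 2 / 3 ^+ k :> R.
    by rewrite !divr_gt0// exprn_gt0.
  have [mn|/ltnW nm] := leqP m n.
    by apply: le_trans (ternary_sum_mono A mn).1 _; rewrite lerDl ltW.
  by apply: le_trans (ternary_sum_mono A nm).2; rewrite lerDl ltW.
have xP A n : ternary_sum A n <= x A <= ternary_sum A n + 3 / 2 / 3 ^+ n.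
  apply/andP; split; last first.
    by apply: ge_sup; [exists (ternary_sum A 0), 0%N|exact: ub].
  apply: ub_le_sup; last by exists n.
  by exists (ternary_sum A 0 + 3 / 2 / 3 ^+ 0); exact: ub.
have sub A B : x A = x B -> forall m,
    (forall i, (i < m)%N -> A i <-> B i) -> A m -> B m.
  move=> xAB m AB Am; apply: contrapT => nBm.
  have sAB : ternary_sum A m = ternary_sum B m.
    by apply: eq_bigr => i _; rewrite (asbool_equiv_eq (AB i (ltn_ord i))).
  have /andP[+ _] := xP A m.+1; have /andP[_ +] := xP B m.+1.
  rewrite xAB /ternary_sum !big_ord_recr /= -!/(ternary_sum _ m) sAB.
  rewrite (asboolT Am) (asboolF nBm) exprS invfM.
  have t1 : 0 < (3 ^+ m)^-1 :> R by rewrite invr_gt0 exprn_gt0.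
  by move=> /= ? ?; lra.
exists x => A B xAB; apply/predeqP => n.
elim/ltn_ind: n => n IH; split; apply: sub => //.
by move=> i /IH[].
Qed.

Lemma irrational_between (x y : R) : x < y ->
  exists p, [/\ x < p, p < y & irrational p].
Proof.
move=> xy; have [F oF iE] := @irrational_Gdelta R.
have /(_ `]x, y[%classic)[| |p [pxy pF]] := Baire oF.
- by exists ((x + y) / 2); rewrite /= in_itv /= !midf_lt.
- exact: interval_open.
move: pxy; rewrite /= in_itv /= => /andP[xp py].
by exists p; split=> //; rewrite iE.
Qed.

End Reals.

(** If [B <= A], the cardinal of size [aleph_1] below [B] has a copy in [A];
    being uncountable, it is at least [A] and hence at least [B]. *)
Lemma aleph1_lt_aleph2 T (A B : set T) : aleph 1 A -> aleph 2 B -> ~ (B #<= A).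
Proof.
move=> [A0 A0nat [_ Asucc]] [B1 [B0 B0nat [[_ nB1B0] _]] [[B1B nBB1] _]] BA.
have /card_subP[C CB1 CA] := card_le_trans B1B BA.
have [CA0|AC] := Asucc _ CA.
  apply: nB1B0; rewrite (card_le_eqr B0nat) -(card_le_eqr A0nat).
  by rewrite -(card_le_eql CB1).
by apply: nBB1; apply: card_le_trans BA _; rewrite -(card_le_eqr CB1).
Qed.

(** * The family of sets *)

Section Family.
Context (R : realType) (e : (nat -> nat) -> R) (eI : injective e).

Definition rat_with (B : set (nat -> nat)) : set R :=
  range (@ratr R) `|` e @` B.

Lemma rat_with_crowded B : crowded (rat_with B).
Proof.
move=> z _ U /nbhs_ballP[r /= r0 rU].
have /rat_in_itvoo[q /itvP qz] : (z < z + r)%R by rewrite ltrDl.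
exists (ratr q); split; first split.
- by left; exists q.
- by move=> /= qzE; have : (z < ratr q)%R by [rewrite qz]; rewrite qzE ltxx.
- by apply: rU; rewrite /ball /= distrC ger0_norm ?subr_ge0 ?ltW ?qz// ltrBlDl qz.
Qed.

(** [rat_with B] embeds into [b * nat], with [e f] at level 0 and the rationals at
    the positive levels, and the infinite set [b] absorbs the factor [nat]. *)
Lemma rat_with_card (b B : set (nat -> nat)) :
  [set: nat] #<= b -> B `<=` b -> rat_with B #<= b.
Proof.
move=> natb Bb; apply/embeds_card_le.
have nat_b : nat ≼ set_type b.
  apply: embeds_trans (iffRL (embeds_card_le _ _) natb).
  by exists (fun n => SigSub (mem_set (I : [set: nat] n))) => m n /(congr1 val).
apply: embeds_trans (embeds_absorb _ _ nat_b); last 2 first.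
- by exists pickle; exact: pcan_inj pickleK.
- by exists pickle; exact: pcan_inj pickleK.
have [i0 _] := nat_b.
pose P (x : R) (p : set_type b * nat) :=
  (p.2 = 0 /\ e (val p.1) = x) \/ exists2 q, p.2 = (pickle q).+1 & ratr q = x.
have tot (x : set_type (rat_with B)) : exists p, P (val x) p.
  case: (set_valP x) => [[q _ qx]|[f Bf fx]].
    by exists (i0 0, (pickle q).+1); right; exists q.
  by exists (SigSub (mem_set (Bb _ Bf)), 0); left.
have [h hP] := choice tot; exists h => x y hxy; apply: val_inj.
have := hP y; rewrite -hxy.
case: (hP x) => [[e1 e2]|[q e1 e2]] [[e1' e2']|[q' e1' e2']].
- by rewrite -e2 -e2'.
- by move: e1; rewrite e1'.
- by move: e1; rewrite e1'.
- move: e1; rewrite e1' => -[/(pcan_inj pickleK) qq'].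
  by rewrite -e2 -e2' qq'.
Qed.

(** By [cone_coding], countably many bits determine [rat_with B].  They
    determine [B] up to the functions that [e] maps to rationals, and countably
    many more bits tell which of those are in [B]. *)
Lemma rat_with_coding (b : set (nat -> nat)) (A : relation) :
  countably_based A ->
  exists dec : set nat * set nat -> set_type (power_set b),
  forall B : set_type (power_set b), tukey_ge A (k_set (rat_with (val B))) ->
    exists c, dec c = B.
Proof.
move=> /(@cone_coding R)[D DP].
pose dec (c : set nat * set nat) :=
  [set f | [/\ b f, D c.1 (e f) & forall q, e f = ratr q -> c.2 (pickle q)]].
have decb c : dec c \in power_set b by apply/mem_set => f [].
exists (fun c => SigSub (decb c)) => B AB.
have [W WB] := DP _ (@rat_with_crowded _) AB.
exists (W, [set w | exists q f, [/\ w = pickle q, val B f & e f = ratr q]]).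
apply: val_inj => /=; apply/seteqP; split=> [f [/= bf]|f Bf].
  rewrite WB => -[[q _ qf]|[g Bg /eI <-//]] /(_ q).
  by rewrite qf => /(_ erefl)[_ [g [/(pcan_inj pickleK) <- Bg]]]; rewrite qf => /eI <-.
split=> /=.
- exact: (set_valP B).
- by rewrite WB; right; exists f.
- by move=> q fq; exists q, f.
Qed.

End Family.

Theorem theorem3p14 (R : realType) (b d : set (nat -> nat)) :
  bounding_number b -> dominating_number d ->
  aleph 1 b ->
  aleph 2 d -> aleph 2 [set: R] ->
  card_lt [set: R] (power_set b) ->
  exists S : set (set R),
    [/\ S #= power_set b,
        forall M : set R, S M -> menger (set_type M),
        forall M : set R, S M ->
          tukey_incomparable (k_relation (set_type M)) omega_omega /\
          strictly_above (k_relation (set_type M))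
            (prod_relation omega_omega_infty omega)
      & forall M N : set R, S M -> S N -> M <> N ->
          ~ tukey_eq (k_relation (set_type M)) (k_relation (set_type N))].
Proof.
move=> _ [_ dmin] b1 d2 _ [_ nbR].
have [j Ij] := @embeds_set_nat_real R.
have [i Ii] := embeds_fun_set_nat.
(* The values are negative, so that [N x] has only rational positive points. *)
pose e f : R := (- expR (j (i f)))%R.
have eI : injective e by move=> f g /oppr_inj/expR_inj/Ij/Ii.
pose N (x : set_type (power_set b)) : set R := rat_with e (val x).
have bN (x : set_type (power_set b)) : val x `<=` b by exact: (set_valP x).
have uN x : undominated (N x).
  move=> g /dmin dg; apply: (aleph1_lt_aleph2 b1 d2).
  apply: card_le_trans dg _; apply: card_le_trans (card_image_le _ _) _.
  apply: rat_with_card (bN x); have [B Bnat [[Bb _] _]] := b1.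
  by rewrite -(card_le_eql Bnat).
have coN x y z : (0 <= y -> y < z -> exists p, [/\ y < p, p < z & ~ N x p])%R.
  move=> y0 /irrational_between[p [yp pz irrp]]; exists p; split=> //.
  move=> [[q _ qp]|[f _ fp]]; first by apply: irrp; exists q.
  have : (0 < p)%R by exact: le_lt_trans yp.
  by rewrite -fp oppr_gt0 ltNge expR_ge0.
pose C := (set nat * set nat)%type.
have C_set_nat : C ≼ set nat by exact: embeds_set_nat_prod.
have CC : (C * C)%type ≼ C by exact: embeds_prod.
have bC : bool ≼ C.
  by apply: embeds_trans embeds_bool_set_nat _; exists (fun A => (A, A)) => A B [].
have XnC : ~ (set_type (power_set b) ≼ C).
  move=> XC; apply: nbR; apply/embeds_card_le.
  apply: embeds_trans XC _; apply: embeds_trans C_set_nat _.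
  by exists (fun A => SigSub (mem_set (I : [set: R] (j A)))) => A B [] /Ij.
have [dec decP] : exists dec, forall x y, tukey_ge (k_set (N x)) (k_set (N y)) ->
    exists c : C, dec x c = y.
  suff /choice[dec decP] : forall x, exists dec : C -> set_type (power_set b),
      forall y, tukey_ge (k_set (N x)) (k_set (N y)) -> exists c : C, dec c = y.
    by exists dec.
  by move=> x; apply: (rat_with_coding eI); exact: k_set_countably_based.
have [dec0 dec0P] := rat_with_coding eI b omega_omega_countably_based.
pose r x := [set y | tukey_eq (k_set (N x)) (k_set (N y))].
have rE x y : r x y -> r x = r y.
  move=> rxy; apply/seteqP; split=> z; apply: tukey_eq_trans => //.
  exact: tukey_eq_sym.
have [|x y []|||T [TX Tgood Tr]] := @card_transversal _ C r
  [set x | tukey_ge omega_omega (k_set (N x))] dec dec0 CC bC XnC _ rE.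
- by move=> x; exact: tukey_eq_refl.
- by move=> /decP.
- by move=> x y [xy _] /tukey_ge_trans; apply.
- exact: dec0P.
have k_ge x B : tukey_ge (k_relation (set_type (N x))) B <-> tukey_ge (k_set (N x)) B.
  by have [? ?] := k_setE (N x); split; exact: tukey_ge_trans.
have ge_k x A : tukey_ge A (k_relation (set_type (N x))) <-> tukey_ge A (k_set (N x)).
  by have [? ?] := k_setE (N x); split=> /tukey_ge_trans; apply.
exists (N @` T); split.
- apply: card_eq_trans (card_eq_trans TX (card_setT _)).
  apply: inj_card_eq => x y /set_mem Tx /set_mem Ty Nxy; apply: Tr => //.
  by rewrite /r /= Nxy; exact: tukey_eq_refl.
- by move=> _ [x _ <-]; exact: menger_undominated.
- move=> _ [x Tx <-].
  have nk : ~ tukey_ge omega_omega (k_relation (set_type (N x))).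
    by move=> /ge_k; exact: Tgood.
  split; split=> //.
  + by move=> /k_ge; exact: k_set_nge_omega_omega.
  + apply/k_ge; apply: k_set_ge_infty_omega; last exact: coN.
    by move=> q; left; exists q.
  + by move=> /(tukey_ge_trans omega_omega_ge_infty_omega).
- move=> _ _ [x Tx <-] [y Ty <-] nxy [xy yx]; apply: nxy; congr N.
  by apply: Tr => //; split; [apply/k_ge/ge_k|apply/k_ge/ge_k].
Qed.
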